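(* The local complexity of the class of penny graphs is $\Theta(n)$.
   Context: A penny graph is the contact graph of pairwise interior-disjoint unit disks in the plane. All graphs are finite, simple, connected; $n$ is the number of vertices, and vertices carry distinct identifiers in $\{1,\dots,\mathrm{poly}(n)\}$. A proof labeling scheme for a class $\mathcal{G}$ consists of a prover assigning a certificate (binary word) to each vertex of each $G\in\mathcal{G}$ and a local verifier in which each vertex accepts or rejects based only on identifiers and certificates in its closed neighborhood; all vertices accept when $G\in\mathcal{G}$ with the prover's certificates, and when $G\notin\mathcal{G}$ some vertex rejects for every certificate assignment. The local complexity of $\mathcal{G}$ is the minimum, over such schemes, of the maximum certificate length used on $n$-vertex graphs of $\mathcal{G}$. *)

(* Defs.v *)
From mathcomp Require Import all_boot.
From Stdlib Require Import Reals.
Set Implicit Arguments. Unset Strict Implicit. Unset Printing Implicit Defensive.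

Definition simple_connected (n : nat) (e : rel 'I_n) : Prop :=
  symmetric e /\ irreflexive e /\ (forall u v : 'I_n, connect e u v).

Definition sqdist (p q : R * R) : R :=
  ((fst p - fst q) * (fst p - fst q) + (snd p - snd q) * (snd p - snd q))%R.

(* Penny graph: centers of pairwise interior-disjoint unit disks (distance >= 2),
   adjacency exactly when the disks touch (distance = 2). *)
Definition penny (n : nat) (e : rel 'I_n) : Prop :=
  exists p : 'I_n -> R * R,
    forall u v : 'I_n, u <> v ->
      (4 <= sqdist (p u) (p v))%R /\ (e u v <-> sqdist (p u) (p v) = 4%R).

Definition valid_ids (k n : nat) (id : 'I_n -> nat) : Prop :=
  injective id /\ (forall v, 1 <= id v <= n ^ k).

(* Local view of v: its identifier and certificate, and the list of
   (identifier, certificate) of its neighbours, listed by increasing identifier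
   (identifiers are distinct, so this is canonical). *)
Definition view (n : nat) (e : rel 'I_n) (id : 'I_n -> nat)
    (c : 'I_n -> seq bool) (v : 'I_n) : nat * seq bool * seq (nat * seq bool) :=
  (id v, c v,
   sort (fun a b : nat * seq bool => a.1 <= b.1)
        [seq (id u, c u) | u <- enum 'I_n & e v u]).

Record scheme := Scheme {
  prover : forall n : nat, rel 'I_n -> ('I_n -> nat) -> 'I_n -> seq bool;
  verifier : nat * seq bool * seq (nat * seq bool) -> bool }.

Definition is_penny_PLS (k : nat) (S : scheme) : Prop :=
  (forall n (e : rel 'I_n) (id : 'I_n -> nat),
     simple_connected e -> penny e -> valid_ids k id ->
     forall v, verifier S (view e id (prover S e id) v)) /\
  (forall n (e : rel 'I_n) (id : 'I_n -> nat),
     simple_connected e -> ~ penny e -> valid_ids k id ->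
     forall c : 'I_n -> seq bool, exists v, ~~ verifier S (view e id c v)).

(* Main.v *)
Require Import Defs.
From mathcomp Require Import all_boot zify.
From Stdlib Require Import Reals Lra Lia ClassicalEpsilon.
(* Reals rebinds [^] on [nat] to [Nat.pow], as in [valid_ids]; this restores [expn]. *)
Import ssrnat.
Set Implicit Arguments. Unset Strict Implicit. Unset Printing Implicit Defensive.

(** Upper bound.  In a unit grid the centers occupy distinct cells, and the
    cells of touching disks differ by at most 2 in each coordinate; hence the
    graph has O(n) edges, and a walk through all edges, recorded by its cell
    displacements (25 possible letters), describes the graph up to isomorphism
    in O(n) bits.  A certificate holds this description of a graph h, the vertex
    of h that it claims to be, and the identifier of the unique vertex claiming
    to be vertex 0.  The local checks make the claims a covering map onto h;
    the fibre over vertex 0 is a single vertex, so the map is injective.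

    Lower bound.  In a penny graph the fourth corner of a rhombus made of two
    triangles is determined, so a strip of triangles is drawn as in the
    triangular lattice.  Two parallel strips, joined at one end by four vertices,
    carry teeth whose positions encode bit strings b (lower strip) and a (upper
    strip); if a and b differ somewhere, two non-adjacent teeth are forced to
    touch, whereas for a = b the graph is penny.  If certificates have fewer than
    n/100 bits, two strings a, b give the same certificates on the four joining
    vertices, and the certificates of the (a, a) and (b, b) graphs combine into
    accepted certificates of the non-penny (a, b) graph. *)

(** * Upper bound *)

Fixpoint blocks (k : nat) (s : seq bool) : seq nat :=
  match s with
  | [::] => [::]
  | true :: s' => blocks k.+1 s'
  | false :: s' => k :: blocks 0 s'
  end.

(** Unary numbers, each closed by [false]: self-delimiting, and a letter below a constant costs O(1)
    bits. *)
Definition unblocks (l : seq nat) : seq bool :=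
  flatten [seq rcons (nseq x true) false | x <- l].

Lemma unblocksK l : blocks 0 (unblocks l) = l.
Proof.
elim: l => //= x l IHl; rewrite /unblocks /= -/(unblocks l) cat_rcons.
suff blocksE k t : blocks k (nseq x true ++ false :: t) = k + x :: blocks 0 t.
  by rewrite blocksE IHl.
by elim: x k => [|x IHx] k /=; rewrite ?addn0 // IHx addnS.
Qed.

Lemma size_unblocks l : size (unblocks l) = sumn l + size l.
Proof.
elim: l => //= x l IHl; rewrite /unblocks /= -/(unblocks l) size_cat IHl.
by rewrite size_rcons size_nseq; lia.
Qed.

Definition of_digits : seq nat -> nat := foldr (fun d x => d + 2 * x) 0.

(** Halving peels off binary digits, least significant first; digits 0 and 1 keep the unary cost
    linear in [m]. *)
Lemma of_digits_surj m x : x < 2 ^ m ->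
  exists r, [/\ size r = m, sumn r <= m & of_digits r = x].
Proof.
elim: m x => [|m IHm] x; first by case: x => // _; exists [::].
rewrite expnS => xlt; have [|r [<- rs rx]] := IHm (x %/ 2); first by lia.
by exists (x %% 2 :: r); rewrite /= rx; split; lia.
Qed.

(* [x] is the claimed vertex, in unary; [r] the binary digits of an identifier;
   [s] the code of the graph. *)
Definition cert (x : nat) (r s : seq nat) : seq bool :=
  unblocks [:: x, size r & r ++ s].
Definition cert_index (c : seq bool) : nat := nth 0 (blocks 0 c) 0.
Definition cert_root (c : seq bool) : nat :=
  of_digits (take (nth 0 (blocks 0 c) 1) (drop 2 (blocks 0 c))).
Definition cert_code (c : seq bool) : seq nat :=
  drop (nth 0 (blocks 0 c) 1) (drop 2 (blocks 0 c)).

Lemma cert_indexE x r s : cert_index (cert x r s) = x.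
Proof. by rewrite /cert_index unblocksK. Qed.

Lemma cert_rootE x r s : cert_root (cert x r s) = of_digits r.
Proof. by rewrite /cert_root unblocksK /= drop0 take_size_cat. Qed.

Lemma cert_codeE x r s : cert_code (cert x r s) = s.
Proof. by rewrite /cert_code unblocksK /= drop0 drop_size_cat. Qed.

Lemma size_cert x r s :
  size (cert x r s) = x + 2 * size r + sumn r + sumn s + size s + 2.
Proof. by rewrite size_unblocks /= sumn_cat size_cat; lia. Qed.

(** * Walks through all edges of a connected graph *)

Section CoveringWalk.
Variables (n : nat) (e : rel 'I_n).
Hypotheses (e_sym : symmetric e) (e_con : forall u v : 'I_n, connect e u v).

Definition uncovered (w0 : 'I_n) (w : seq 'I_n) : pred ('I_n * 'I_n) :=
  [pred p | e p.1 p.2 & p \notin pairmap pair w0 w].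

Lemma mem_pairmap_behead (w0 : 'I_n) w p :
  p \in pairmap pair w0 w -> p.2 \in w0 :: w.
Proof.
elim: w w0 => //= v w IHw w0; rewrite !inE => /predU1P[->|/IHw] /=.
  by rewrite eqxx orbT.
by rewrite inE => ->; rewrite orbT.
Qed.

(** A detour [u], [v], [u] spliced in at a visit of [u] covers the directed edge [(u, v)], keeps all
    old consecutive pairs and costs two steps. *)
Lemma extend_walk (w0 : 'I_n) w p : path e w0 w -> uncovered w0 w p ->
  exists w', [/\ path e w0 w', size w' = size w + 2 &
                 #|uncovered w0 w'| < #|uncovered w0 w|].
Proof.
move=> wP pU.
have [[u v] /andP[/= euv uvN] uw] :
    exists2 p, uncovered w0 w p & p.1 \in w0 :: w.
  (* Otherwise the visited set is closed under adjacency, so by connectivity it contains [p.1], and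
     [p] itself is a witness. *)
  apply: NNPP => noex.
  have closed u v : connect e u v -> u \in w0 :: w -> v \in w0 :: w.
    move=> /connectP[s]; elim: s u => [|x s IHs] u /=; first by move=> _ ->.
    case/andP=> eux xs lst uw; apply: (IHs x) => //.
    case: (boolP ((u, x) \in pairmap pair w0 w)) => [/mem_pairmap_behead //|N].
    by case: noex; exists (u, x) => //; rewrite /uncovered /= eux.
  by apply: noex; exists p => //; apply: closed (e_con w0 _) _; rewrite inE eqxx.
case/splitPl: uw wP pU uvN => w1 w2 lst; rewrite cat_path => /andP[w1P w2P] _ uvN.
exists (w1 ++ [:: v, u & w2]); split.
- by rewrite cat_path w1P /= lst euv e_sym euv -lst.
- by rewrite !size_cat /=; lia.
apply: proper_card; apply/properP; split.
  apply/subsetP=> -[x y]; rewrite !inE /= => /andP[-> /=]; apply: contra.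
  rewrite !pairmap_cat !mem_cat /= lst => /orP[->//|H].
  by rewrite !inE H !orbT.
exists (u, v); first by rewrite !inE /= euv.
by rewrite !inE /= euv pairmap_cat mem_cat /= lst inE eqxx orbT.
Qed.

Lemma covering_walk (w0 : 'I_n) :
  exists w, [/\ path e w0 w, size w <= 2 * #|[pred p | e p.1 p.2]| &
                forall u v, e u v -> (u, v) \in pairmap pair w0 w].
Proof.
suff ext k w : path e w0 w -> #|uncovered w0 w| <= k ->
    exists w', [/\ path e w0 w', size w' <= size w + 2 * k &
                forall u v, e u v -> (u, v) \in pairmap pair w0 w'].
  apply: (ext _ [::]) => //; apply/subset_leq_card/subsetP=> p.
  by rewrite !inE => /andP[].
elim: k w => [|k IHk] w wP; case: (pickP (uncovered w0 w)) => [p pU|none] le_k.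
- by move: le_k; rewrite (cardD1 p) [_ \in _]pU.
- exists w; split=> //; first by lia.
  by move=> u v euv; move: (none (u, v)); rewrite /uncovered /= euv => /negbFE.
- have [w' [w'P sw' lt]] := extend_walk wP pU.
  have [|w'' [? ? ?]] := IHk _ w'P; first by lia.
  by exists w''; split=> //; lia.
exists w; split=> //; first by lia.
by move=> u v euv; move: (none (u, v)); rewrite /uncovered /= euv => /negbFE.
Qed.

End CoveringWalk.

(** * Grid drawings and their codes *)

Definition near (p q : Z * Z) : Prop :=
  (-2 <= q.1 - p.1 <= 2 /\ -2 <= q.2 - p.2 <= 2)%Z.

(* Injective in [q] only for [near p q], because [Z.to_nat] truncates. *)
Definition letter (p q : Z * Z) : nat :=
  Z.to_nat ((q.1 - p.1 + 2) * 5 + (q.2 - p.2 + 2)).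

Lemma letter_lt p q : near p q -> letter p q < 25.
Proof. by case: p q => [? ?] [? ?]; rewrite /near /letter /= ; lia. Qed.

Lemma letter_inj p q r : near p q -> near p r -> letter p q = letter p r -> q = r.
Proof.
case: p q r => [? ?] [? ?] [? ?]; rewrite /near /letter /= => ? ? ?.
by congr pair; lia.
Qed.

(** With [w0] anchored at the origin, the displacements in [s] recover all positions, and the walk
    meets every vertex and edge. *)
Record drawing (n : nat) (e : rel 'I_n) (s : seq nat)
    (q : 'I_n -> Z * Z) (w0 : 'I_n) (w : seq 'I_n) : Prop := Drawing {
  drawing_inj : injective q;
  drawing0 : q w0 = (0%Z, 0%Z);
  drawing_near : forall u v, e u v -> near (q u) (q v);
  drawing_path : path e w0 w;
  drawing_mem : forall v, v \in w0 :: w;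
  drawing_edges : forall u v, e u v -> (u, v) \in pairmap pair w0 w;
  drawing_code : s = pairmap (fun u v => letter (q u) (q v)) w0 w }.

Definition codes (s : seq nat) (n : nat) (e : rel 'I_n) : Prop :=
  exists q w0 w, drawing e s q w0 w.

Section CodeUnique.
Variables (n m : nat) (e : rel 'I_n) (f : rel 'I_m) (s : seq nat).

Lemma drawing_size q w0 w : drawing e s q w0 w -> size w = size s.
Proof. by case=> *; subst s; rewrite size_pairmap. Qed.

(** Both walks start at the origin, and a letter determines the next position from the current
    one. *)
Lemma drawing_positions q w0 w q' x0 x :
  drawing e s q w0 w -> drawing f s q' x0 x ->
  [seq q v | v <- w0 :: w] = [seq q' v | v <- x0 :: x].
Proof.
case=> _ q0 qn wP _ _ ->; case=> _ q0' qn' xP _ _.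
move: q0; rewrite -q0' => {q0'}.
elim: w w0 x x0 wP xP => [|v w IHw] w0 [|y x] x0 //=; first by move=> _ _ ->.
case/andP=> ewv wP /andP[fxy xP] q0 [lE sE].
have qE : q v = q' y.
  by apply: (letter_inj (qn _ _ ewv)); rewrite q0 //; [exact: qn' | rewrite -lE q0].
by rewrite q0; congr (_ :: _); apply: (IHw _ _ _ wP xP qE sE).
Qed.

End CodeUnique.

(** The walks are at equal positions at equal times; an edge traversed by [w] at some step is
    matched by the edge that [x] traverses at that step. *)
Lemma drawing_hom (n m : nat) (e : rel 'I_n) (f : rel 'I_m) s q w0 w q' x0 x :
  drawing e s q w0 w -> drawing f s q' x0 x ->
  exists g : 'I_n -> 'I_m,
    (forall v, q' (g v) = q v) /\ (forall u v, e u v -> f (g u) (g v)).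
Proof.
move=> dw dx; have posE := drawing_positions dw dx.
have szE : size w = size x by rewrite (drawing_size dw) (drawing_size dx).
have nthE i : i <= size w -> q' (nth x0 (x0 :: x) i) = q (nth w0 (w0 :: w) i).
  by move=> ile; rewrite -!(nth_map _ (0%Z, 0%Z)) ?posE //= -szE ltnS.
(* [index] picks the first visit of [v]; injectivity of [q'] makes all other visits agree with
   it. *)
pose g v := nth x0 (x0 :: x) (index v (w0 :: w)).
have gE v : q' (g v) = q v.
  have vw := drawing_mem dw v.
  by rewrite nthE ?nth_index //; move: vw; rewrite -index_mem.
exists g; split=> // u v /(drawing_edges dw).
case/(nthP (w0, w0)) => i; rewrite size_pairmap => ilt.
rewrite (nth_pairmap w0) // => -[uE vE].
have gu : g u = nth x0 (x0 :: x) i.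
  by apply: (drawing_inj dx); rewrite gE nthE ?uE // ltnW.
have gv : g v = nth x0 x i.
  apply: (drawing_inj dx).
  by rewrite gE -[nth x0 x i]/(nth x0 (x0 :: x) i.+1) nthE //= vE.
by rewrite gu gv; have /(pathP x0) := drawing_path dx; apply; rewrite -szE.
Qed.

(** The homomorphisms in the two directions preserve positions, hence are mutually inverse. *)
Lemma codes_iso (n m : nat) (e : rel 'I_n) (f : rel 'I_m) s :
  codes s e -> codes s f ->
  exists (g : 'I_n -> 'I_m) (h : 'I_m -> 'I_n),
    [/\ cancel g h, cancel h g & forall u v, e u v = f (g u) (g v)].
Proof.
move=> [q [w0 [w dw]]] [q' [x0 [x dx]]].
have [g [gq gE]] := drawing_hom dw dx; have [h [hq hE]] := drawing_hom dx dw.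
have gK : cancel g h by move=> v; apply: (drawing_inj dw); rewrite hq gq.
have hK : cancel h g by move=> v; apply: (drawing_inj dx); rewrite gq hq.
exists g, h; split=> // u v; apply/idP/idP; first exact: gE.
by move/hE; rewrite !gK.
Qed.

Lemma up_near x y : (-2 <= y - x <= 2)%R -> (-2 <= up y - up x <= 2)%Z.
Proof.
move=> [l r]; have [xl xr] := archimed x; have [yl yr] := archimed y.
have: (IZR (up y - up x) < 3)%R by rewrite minus_IZR; lra.
have: (-3 < IZR (up y - up x))%R by rewrite minus_IZR; lra.
by move=> /lt_IZR ? /lt_IZR ?; lia.
Qed.

Lemma up_eq x y : up x = up y -> (-1 < y - x < 1)%R.
Proof.
by move=> E; have := archimed x; have := archimed y; rewrite E; lra.
Qed.

Lemma sum_sqr4 x y : (x * x + y * y = 4 -> -2 <= x <= 2)%R.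
Proof. by move=> ?; split; nra. Qed.

Lemma penny_codes (n : nat) (e : rel 'I_n) (v0 : 'I_n) :
  simple_connected e -> penny e ->
  exists s, [/\ codes s e, size s <= 50 * n & all (ltn^~ 25) s].
Proof.
move=> [e_sym [e_irr e_con]] [p pP].
(* [up] is floor plus one, so it names the unit cell of a center; [q] moves the cell of [v0] to the
   origin. *)
pose cell v := (up (p v).1, up (p v).2).
pose q v := ((cell v).1 - (cell v0).1, (cell v).2 - (cell v0).2)%Z.
have q_inj : injective q.
  (* Two centers in one cell would be at squared distance below 2. *)
  move=> u v [E1 E2]; apply: NNPP => /pP[+ _]; rewrite /sqdist.
  have [l1 r1] : (-1 < (p v).1 - (p u).1 < 1)%R by apply: up_eq; lia.
  have [l2 r2] : (-1 < (p v).2 - (p u).2 < 1)%R by apply: up_eq; lia.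
  by nra.
have q_near u v : e u v -> near (q u) (q v).
  move=> euv; have uv : u <> v by move=> E; rewrite E e_irr in euv.
  have {euv} := (pP u v uv).2.1 euv; rewrite /sqdist /near /q /cell /= => E.
  have shiftE (a b c : Z) : (b - c - (a - c) = b - a)%Z by lia.
  rewrite !shiftE.
  have := sum_sqr4 E; rewrite Rplus_comm in E; have := sum_sqr4 E.
  by split; apply: up_near; lra.
have [w [wP wsz wE]] := covering_walk e_sym e_con v0.
exists (pairmap (fun u v => letter (q u) (q v)) v0 w); split.
- exists q, v0, w; split=> //; first by rewrite /q !Z.sub_diag.
  move=> v; case: (eqVneq v v0) => [->|vv0]; first by rewrite inE eqxx.
  case/connectP: (e_con v0 v) => s; case: (lastP s) => [|s' z] /=.
    by move=> _ E; rewrite E eqxx in vv0.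
  rewrite rcons_path last_rcons => /andP[_ /wE/mem_pairmap_behead /=] zw ->.
  exact: zw.
- rewrite size_pairmap (leq_trans wsz) // -[50]/(2 * 25) -mulnA leq_mul2l /=.
  (* A directed edge is determined by its source and its letter, so there are at most 25n of
     them. *)
  pose F (x : 'I_n * 'I_n) : 'I_n * 'I_25 := (x.1, inord (letter (q x.1) (q x.2))).
  have F_inj : {in [pred x | e x.1 x.2] &, injective F}.
    move=> [u v] [u' v']; rewrite !inE /= => euv euv' [E]; subst u'.
    move/(congr1 val); rewrite /= !inordK; try exact/letter_lt/q_near.
    by move/(letter_inj (q_near _ _ euv) (q_near _ _ euv'))/q_inj ->.
  rewrite -(card_in_image F_inj) (leq_trans (max_card _)) //.
  by rewrite card_prod !card_ord mulnC.
apply/(all_nthP 0) => i; rewrite size_pairmap => ilt.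
by rewrite (nth_pairmap v0) //; apply/letter_lt/q_near/(pathP v0 wP).
Qed.

(** * Verification by a covering map *)

Definition view_type : Type := (nat * seq bool * seq (nat * seq bool))%type.

(** Unique up to isomorphism by [codes_iso] when such a graph exists, arbitrary otherwise; hence
    [accepts] tests [penny] and [simple_connected] again. *)
Definition decode (s : seq nat) : {n & rel 'I_n} :=
  epsilon (inhabits (existT (fun n => rel 'I_n) 0 (fun _ _ => false)))
    (fun H => [/\ codes s (tagged H), penny (tagged H)
                & simple_connected (tagged H)]).

(** The last three clauses make the claims a bijection from the neighbours of the viewing vertex to
    those of [y]; the second ties vertex 0 to one identifier. *)
Definition accepts (x : view_type) : Prop :=
  let: (i, c, nb) := x in
  let: existT m h := decode (cert_code c) in
  [/\ penny h, simple_connected h & exists y : 'I_m,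
    [/\ val y = cert_index c,
        val y = 0 -> i = cert_root c,
        forall a, a \in nb ->
          [/\ cert_code a.2 = cert_code c, cert_root a.2 = cert_root c &
              exists2 z, h y z & val z = cert_index a.2],
        forall z, h y z -> exists2 a, a \in nb & cert_index a.2 = val z &
        forall a b, a \in nb -> b \in nb ->
          cert_index a.2 = cert_index b.2 -> a.1 = b.1]].

Lemma mem_view (n : nat) (e : rel 'I_n) id c v (a : nat * seq bool) :
  reflect (exists2 u, e v u & a = (id u, c u)) (a \in (view e id c v).2).
Proof.
rewrite mem_sort; apply: (iffP mapP) => [[u]|[u evu ->]].
  by rewrite mem_filter => /andP[evu _] ->; exists u.
by exists u => //; rewrite mem_filter evu mem_enum.
Qed.

Lemma accepts_penny (n : nat) (e : rel 'I_n) id c :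
  simple_connected e -> injective id ->
  (forall v, accepts (view e id c v)) -> penny e.
Proof.
move=> [e_sym [_ e_con]] id_inj acc.
have [v0 _|e0] := pickP (pred_of_simpl (@predT 'I_n)); last first.
  by exists (fun _ => (0%R, 0%R)) => u; have := e0 u.
case D: (decode (cert_code (c v0))) => [m h].
(* Agreement between neighbours spreads along paths, so all vertices decode the same graph and name
   the same root. *)
have const v : cert_code (c v) = cert_code (c v0) /\ cert_root (c v) = cert_root (c v0).
  have /connectP[s] := e_con v0 v; elim/last_ind: s v => [|s u IHs] v /=.
    by move=> _ ->.
  rewrite rcons_path last_rcons => /andP[sP esu] ->{v}.
  have [cE rE] := IHs _ sP erefl; rewrite -cE -rE.
  have := acc (last v0 s); rewrite /accepts /= cE D => -[_ _ [y [_ _ nbE _ _]]].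
  have [|-> -> _] := nbE (id u, c u); last by [].
  by apply/mem_view; exists u.
have [hp [h_sym [_ h_con]]] : penny h /\ simple_connected h.
  by have := acc v0; rewrite /accepts /= D => -[].
have /(choice (fun v y => _)) [f fP] v : exists y : 'I_m,
    [/\ val y = cert_index (c v), val y = 0 -> id v = cert_root (c v0),
        forall u, e v u -> exists2 z, h y z & val z = cert_index (c u),
        forall z, h y z -> exists2 u, e v u & cert_index (c u) = val z &
        forall u w, e v u -> e v w -> cert_index (c u) = cert_index (c w) -> u = w].
  have := acc v; rewrite /accepts /= (const v).1 D => -[_ _ [y [yE y0 nb1 nb2 nb3]]].
  exists y; split=> // [/y0 ->|u evu|z /nb2[a]|u w evu evw E].
  - by rewrite (const v).2.
  - by have [|_ _] := nb1 (id u, c u); first by apply/mem_view; exists u.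
  - by case/mem_view=> u evu -> /= E; exists u.
  apply: id_inj; apply: (nb3 (id u, c u) (id w, c w)) => //.
    by apply/mem_view; exists u.
  by apply/mem_view; exists w.
have fE v : cert_index (c v) = val (f v) by case: (fP v).
have f_hom u v : e u v -> h (f u) (f v).
  case: (fP u) => _ _ H _ _ /H[z hz zE].
  by rewrite (_ : f v = z) //; apply: val_inj; rewrite -fE zE.
have f_lift v z : h (f v) z -> exists2 u, e v u & f u = z.
  case: (fP v) => _ _ _ H _ /H[u evu uE].
  by exists u => //; apply: val_inj; rewrite -fE.
(* Lift a path of [h] ending at vertex 0 from both points: the lifts end at
   the same vertex, and local injectivity brings this back to the start. *)
have f_inj : injective f.
  have m_gt0 : 0 < m by case: (m) (f v0) => // -[].
  have root u : f u = Ordinal m_gt0 -> id u = cert_root (c v0).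
    by case: (fP u) => _ + _ _ _ E; rewrite E; apply.
  suff lift y s (u v : 'I_n) : path h y s -> last y s = Ordinal m_gt0 ->
      f u = y -> f v = y -> u = v.
    move=> u v E; have /connectP[s sP lst] := h_con (f u) (Ordinal m_gt0).
    exact: (lift (f u) s).
  elim: s y u v => [|z s IHs] y u v /=.
    move=> _ y0 fu fv; apply: id_inj.
    by rewrite !root ?fu ?fv.
  case/andP=> hyz sP lst fu fv.
  have [|u' euu' fu'] := f_lift u z; first by rewrite fu.
  have [|v' evv' fv'] := f_lift v z; first by rewrite fv.
  have E := IHs _ u' v' sP lst fu' fv'; subst v'.
  have [_ _ _ _] := fP u'; apply; rewrite 1?e_sym //.
  by rewrite !fE fu fv.
(* Centers pull back along [f]. An edge of [h] from [f u] to [f v] lifts to an edge at [u] that ends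
   in [v] by injectivity. *)
have [p pP] := hp; exists (p \o f) => u v uv.
have [|d4 dE] := pP (f u) (f v); first by move/f_inj.
split=> //; rewrite -dE; split=> [/f_hom //|/f_lift[w euw /f_inj wv]].
by rewrite -wv.
Qed.

Lemma pow_expn n k : Nat.pow n k = n ^ k.
Proof. by elim: k => //= k ->; rewrite expnS. Qed.

Lemma accepts_complete (k n : nat) (e : rel 'I_n) id :
  simple_connected e -> penny e -> valid_ids k id ->
  exists c : 'I_n -> seq bool, forall v,
    size (c v) <= (1306 + 3 * k) * n /\ accepts (view e id c v).
Proof.
move=> econ ep [id_inj id_le].
have [v0 _|e0] := pickP (pred_of_simpl (@predT 'I_n)); last first.
  by exists (fun _ => [::]) => v; have := e0 v.
have n_gt0 : 0 < n by case: (n) v0 => // -[].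
have [s [sc ssz slt]] := penny_codes v0 econ ep.
have : [/\ codes s (tagged (decode s)), penny (tagged (decode s))
          & simple_connected (tagged (decode s))].
  apply: (epsilon_spec _ (fun H : {n & rel 'I_n} => [/\ codes s (tagged H),
    penny (tagged H) & simple_connected (tagged H)])).
  by exists (existT (fun n => rel 'I_n) n e).
case D: (decode s) => [m h] /= [hc hp hcon].
(* The decoded graph is only an isomorphic copy of [e], so claims are made through [g]. *)
have [g [g' [gK g'K gE]]] := codes_iso sc hc.
have mE : m = n.
  by rewrite -[m]card_ord -[n]card_ord; apply/esym/bij_eq_card; exists g'.
have m_gt0 : 0 < m by rewrite mE.
have [r [rsz rsum rE]] : exists r, [/\ size r = (k + 1) * n, sumn r <= (k + 1) * n &
    of_digits r = id (g' (Ordinal m_gt0))].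
  (* The crude bound n^k < 2^((k+1)n) suffices, as linearly many digits fit. *)
  apply: of_digits_surj; have /andP[_] := id_le (g' (Ordinal m_gt0)).
  rewrite pow_expn => /leq_ltn_trans; apply.
  rewrite mulnDl mul1n expnD [k * n]mulnC expnM.
  have le_k : n ^ k <= (2 ^ n) ^ k.
    by case: (k) => // j; rewrite leq_exp2r // ltnW // ltn_expl.
  apply: (leq_ltn_trans le_k); rewrite ltn_Pmulr ?expn_gt0 //.
  by rewrite -{1}(expn0 2) ltn_exp2l.
have s_sum : sumn s <= 25 * size s.
  by elim: s slt {ssz sc hc D} => //= x s IHs /andP[? /IHs]; lia.
exists (fun v => cert (g v) r s) => v; split.
  (* The code costs at most 1250n + 50n bits, the digits with their count 3(k+1)n, and the index
     with two terminators at most 2n. *)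
  rewrite size_cert rsz; have := ltn_ord (g v); rewrite {2}mE.
  by move: rsum; rewrite [(_ + 3 * k) * n]mulnDl -[3 * k * n]mulnA mulnDl; lia.
rewrite /accepts /= cert_codeE D; split=> //; exists (g v).
rewrite cert_indexE cert_rootE rE; split=> //.
- by move=> g0; rewrite -[v]gK; congr (id (g' _)); apply: val_inj.
- move=> a /mem_view[u evu ->] /=; rewrite cert_codeE cert_rootE cert_indexE rE.
  by split=> //; exists (g u) => //; rewrite -gE.
- move=> z hz; exists (id (g' z), cert (g (g' z)) r s).
    by apply/mem_view; exists (g' z) => //; rewrite gE g'K.
  by rewrite /= cert_indexE g'K.
move=> a b /mem_view[u _ ->] /mem_view[w _ ->] /=; rewrite !cert_indexE.
by move/val_inj/(can_inj gK) ->.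
Qed.

Definition penny_verifier (x : view_type) : bool :=
  if excluded_middle_informative (accepts x) then true else false.

Lemma penny_verifierP x : reflect (accepts x) (penny_verifier x).
Proof.
by rewrite /penny_verifier; case: excluded_middle_informative; constructor.
Qed.

Definition penny_scheme (k : nat) : scheme :=
  Scheme (fun n e id => epsilon (inhabits (fun _ => [::]))
            (fun c : 'I_n -> seq bool => forall v,
               size (c v) <= (1306 + 3 * k) * n /\ accepts (view e id c v)))
         penny_verifier.

Lemma penny_proverP (k n : nat) (e : rel 'I_n) id v :
  simple_connected e -> penny e -> valid_ids k id ->
  size (prover (penny_scheme k) e id v) <= (1306 + 3 * k) * n /\
  accepts (view e id (prover (penny_scheme k) e id) v).
Proof.
move=> econ ep idP.
exact: (epsilon_spec (inhabits (fun _ => [::])) _ (accepts_complete econ ep idP)).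
Qed.

Lemma penny_schemeP (k : nat) : is_penny_PLS k (penny_scheme k).
Proof.
split=> n e id econ ep idP.
  by move=> v; apply/penny_verifierP; case: (penny_proverP v econ ep idP).
move=> c; apply: NNPP => acc; apply/ep/(accepts_penny (id := id) (c := c) econ).
  by case: idP.
by move=> v; apply/penny_verifierP/negPn/negP => rej; case: acc; exists v.
Qed.

(** * Lower bound *)

Definition adj (p q : nat * nat) : bool :=
  [|| (p.2 == q.2) && ((p.1 == q.1 + 1) || (q.1 == p.1 + 1)),
      (p.1 == q.1) && ((p.2 == q.2 + 1) || (q.2 == p.2 + 1)) |
      (p.1 + p.2 == q.1 + q.2) && ((p.1 == q.1 + 1) || (q.1 == p.1 + 1))].

Lemma adjC p q : adj p q = adj q p.
Proof. by case: p q => [? ?] [? ?]; rewrite /adj /=; lia. Qed.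

Lemma adj_norm (x y : Z) : (0 < x * x + x * y + y * y)%Z \/ (x = 0 /\ y = 0)%Z.
Proof. by nia. Qed.

Lemma adj_norm1 (x y : Z) : (x * x + x * y + y * y = 1)%Z <->
  [\/ (y = 0 /\ (x = 1 \/ x = -1))%Z, (x = 0 /\ (y = 1 \/ y = -1))%Z
   | (x + y = 0 /\ (x = 1 \/ x = -1))%Z].
Proof.
split; last by case=> -[? [?|?]]; subst; nia.
move=> E; have [? ?] : (-1 <= x <= 1 /\ -1 <= y <= 1)%Z by nia.
have [?|[?|?]] : (x = -1 \/ x = 0 \/ x = 1)%Z by lia.
all: have [?|[?|?]] : (y = -1 \/ y = 0 \/ y = 1)%Z by lia.
all: subst; try lia.
all: try (by constructor 1; lia); try (by constructor 2; lia).
all: by constructor 3; lia.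
Qed.

Lemma lattice_penny (n : nat) (e : rel 'I_n) (site : 'I_n -> nat * nat) :
  injective site -> (forall u v, e u v = adj (site u) (site v)) -> penny e.
Proof.
move=> site_inj eE.
(* The axes meet at 60 degrees with spacing 2, so squared distance is 4(x^2 + xy + y^2), and the six
   solutions of norm 1 are the directions in [adj]. *)
exists (fun v => (2 * INR (site v).1 + INR (site v).2, sqrt 3 * INR (site v).2)%R).
move=> u v uv; rewrite eE.
have : site u <> site v by move/site_inj.
case: (site u) (site v) => [i j] [i' j'] puv; rewrite /sqdist /=.
set x := (Z.of_nat i - Z.of_nat i')%Z; set y := (Z.of_nat j - Z.of_nat j')%Z.
have -> : ((2 * INR i + INR j - (2 * INR i' + INR j')) *
    (2 * INR i + INR j - (2 * INR i' + INR j')) +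
    (sqrt 3 * INR j - sqrt 3 * INR j') * (sqrt 3 * INR j - sqrt 3 * INR j') =
    4 * IZR (x * x + x * y + y * y))%R.
  rewrite !plus_IZR !mult_IZR !minus_IZR -!INR_IZR_INZ.
  have := sqrt_sqrt 3 ltac:(lra); set s := sqrt 3 => sE.
  have -> : ((s * INR j - s * INR j') * (s * INR j - s * INR j') =
    (s * s) * ((INR j - INR j') * (INR j - INR j')))%R by ring.
  by rewrite sE; ring.
split.
  suff : (1 <= IZR (x * x + x * y + y * y))%R by lra.
  apply: IZR_le; have [|[? ?]] := adj_norm x y; first by lia.
  by case: puv; congr pair; lia.
have -> : (4 * IZR (x * x + x * y + y * y) = 4)%R <-> (x * x + x * y + y * y = 1)%Z.
  by split=> [E|->]; [apply: eq_IZR; lra | lra].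
rewrite adj_norm1 /adj /=; split.
  move=> H; have [?|[?|?]] : (y = 0 /\ (x = 1 \/ x = -1) \/
      (x = 0 /\ (y = 1 \/ y = -1)) \/ (x + y = 0 /\ (x = 1 \/ x = -1)))%Z by lia.
  - by constructor 1.
  - by constructor 2.
  - by constructor 3.
by case; lia.
Qed.

(** Seen from the midpoint of [u] and [w], both [x] and [v] are orthogonal to [u - w] with length
    sqrt 3, so they are equal or opposite; separation excludes equality. *)
Lemma rhombus (x u w v : R * R) :
  sqdist x u = 4%R -> sqdist x w = 4%R -> sqdist u w = 4%R ->
  sqdist v u = 4%R -> sqdist v w = 4%R -> (4 <= sqdist x v)%R ->
  v.1 = (u.1 + w.1 - x.1)%R /\ v.2 = (u.2 + w.2 - x.2)%R.
Proof.
case: x u w v => [x1 x2] [u1 u2] [w1 w2] [v1 v2]; rewrite /sqdist /=.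
pose y1 := (x1 - (u1 + w1) / 2)%R; pose y2 := (x2 - (u2 + w2) / 2)%R.
pose z1 := (v1 - (u1 + w1) / 2)%R; pose z2 := (v2 - (u2 + w2) / 2)%R.
pose d1 := ((u1 - w1) / 2)%R; pose d2 := ((u2 - w2) / 2)%R.
have -> : x1 = (y1 + (u1 + w1) / 2)%R by rewrite /y1; lra.
have -> : x2 = (y2 + (u2 + w2) / 2)%R by rewrite /y2; lra.
have -> : v1 = (z1 + (u1 + w1) / 2)%R by rewrite /z1; lra.
have -> : v2 = (z2 + (u2 + w2) / 2)%R by rewrite /z2; lra.
move: y1 y2 z1 z2 => y1 y2 z1 z2 Hxu Hxw Huw Hvu Hvw Hxv.
have dd : (d1 * d1 + d2 * d2 = 1)%R by rewrite /d1 /d2; lra.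
have yd : (y1 * d1 + y2 * d2 = 0)%R by rewrite /d1 /d2; lra.
have zd : (z1 * d1 + z2 * d2 = 0)%R by rewrite /d1 /d2; lra.
have yy : (y1 * y1 + y2 * y2 = 3)%R by rewrite /d1 /d2 in dd; lra.
have zz : (z1 * z1 + z2 * z2 = 3)%R by rewrite /d1 /d2 in dd; lra.
have {}Hxv : (y1 * z1 + y2 * z2 <= 1)%R by lra.
have cross : (y1 * z2 - y2 * z1 = 0)%R.
  have c1 : ((y1 * z2 - y2 * z1) * d1 = 0)%R.
    have -> : ((y1 * z2 - y2 * z1) * d1 =
      z2 * (y1 * d1 + y2 * d2) - y2 * (z1 * d1 + z2 * d2))%R by ring.
    by rewrite yd zd; ring.
  have c2 : ((y1 * z2 - y2 * z1) * d2 = 0)%R.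
    have -> : ((y1 * z2 - y2 * z1) * d2 =
      y1 * (z1 * d1 + z2 * d2) - z1 * (y1 * d1 + y2 * d2))%R by ring.
    by rewrite yd zd; ring.
  have -> : (y1 * z2 - y2 * z1 =
    (y1 * z2 - y2 * z1) * d1 * d1 + (y1 * z2 - y2 * z1) * d2 * d2)%R.
    by rewrite -[LHS]Rmult_1_r -dd; ring.
  by rewrite c1 c2; ring.
have dot : ((y1 * z1 + y2 * z2) * (y1 * z1 + y2 * z2) = 9)%R.
  have -> : ((y1 * z1 + y2 * z2) * (y1 * z1 + y2 * z2) =
    (y1 * y1 + y2 * y2) * (z1 * z1 + z2 * z2) -
    (y1 * z2 - y2 * z1) * (y1 * z2 - y2 * z1))%R by ring.
  by rewrite yy zz cross; ring.
(* The product is 3 or -3, and separation bounds it by 1. *)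
have {}dot : (y1 * z1 + y2 * z2 = -3)%R by nra.
have sum0 : ((y1 + z1) * (y1 + z1) + (y2 + z2) * (y2 + z2) = 0)%R by lra.
have [e1 e2] : (y1 + z1 = 0)%R /\ (y2 + z2 = 0)%R by exact: Rplus_sqr_eq_0.
by lra.
Qed.

(** * The two-strip gadget *)

Section Gadget.
Variables (T : nat) (a b : nat -> bool).

(* [T] blocks of four columns.  Rows 0-1 and 4-5 are triangulated strips of
   [width] columns; the four connectors fill rows 2-3 of columns 0-1; block [t]
   has a tooth on the lower strip (row 2) placed by [b t] and a tooth on the
   upper strip (row 3) placed by [a t]; leftover vertices prolong row 0. *)
Definition width : nat := 4 * T + 4.

Definition site (v : nat) : nat * nat :=
  if v < 4 * width then (v %/ 4, v %% 4 + 2 * (1 < v %% 4))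
  else if v < 4 * width + 4 then
    ((v - 4 * width) %% 2, 2 + (v - 4 * width) %/ 2)
  else if v < 4 * width + 4 + T then
    (4 * (v - (4 * width + 4)) + 3 + 2 * b (v - (4 * width + 4)), 2)
  else if v < 4 * width + 4 + 2 * T then
    (4 * (v - (4 * width + 4 + T)) + 5 - 2 * a (v - (4 * width + 4 + T)), 3)
  else (width + (v - (4 * width + 4 + 2 * T)), 0).

Variant site_spec (v : nat) : nat * nat -> Prop :=
  | SiteStrip i r of v = 4 * i + r & r < 4 & i < width :
      site_spec v (i, r + 2 * (1 < r))
  | SiteConn i j of v = 4 * width + 2 * j + i & i < 2 & j < 2 :
      site_spec v (i, 2 + j)
  | SiteBot t of v = 4 * width + 4 + t & t < T :
      site_spec v (4 * t + 3 + 2 * b t, 2)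
  | SiteTop t of v = 4 * width + 4 + T + t & t < T :
      site_spec v (4 * t + 5 - 2 * a t, 3)
  | SitePad s of v = 4 * width + 4 + 2 * T + s : site_spec v (width + s, 0).

Lemma siteP v : site_spec v (site v).
Proof.
rewrite /site; case: ifP => [lt|ge1]; first by apply: SiteStrip; lia.
case: ifP => [lt|ge2]; first by apply: SiteConn; lia.
case: ifP => [lt|ge3]; first by apply: SiteBot; lia.
case: ifP => [lt|ge4]; first by apply: SiteTop; lia.
by apply: SitePad; lia.
Qed.

Lemma site_strip i r : i < width -> r < 4 -> site (4 * i + r) = (i, r + 2 * (1 < r)).
Proof. by move=> iw r4; rewrite /site ifT; [congr (_, _ + 2 * (1 < _)) | ]; lia. Qed.

Lemma site_conn i j : i < 2 -> j < 2 -> site (4 * width + 2 * j + i) = (i, 2 + j).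
Proof.
by move=> i2 j2; rewrite /site ifF; [rewrite ifT; [congr pair | ] | ]; lia.
Qed.

Lemma site_bot t : t < T -> site (4 * width + 4 + t) = (4 * t + 3 + 2 * b t, 2).
Proof.
move=> tT; rewrite /site ifF; [rewrite ifF; [rewrite ifT | ] | ]; try lia.
by rewrite addKn.
Qed.

Lemma site_top t : t < T -> site (4 * width + 4 + T + t) = (4 * t + 5 - 2 * a t, 3).
Proof.
move=> tT; rewrite /site ifF; [|lia].
rewrite ifF; [|lia]; rewrite ifF; [|lia]; rewrite ifT; [|lia].
by rewrite addKn.
Qed.

Lemma site_pad s : site (4 * width + 4 + 2 * T + s) = (width + s, 0).
Proof.
by rewrite /site !ifF; [rewrite addKn | lia ..].
Qed.

Lemma site_inj : injective site.
Proof.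
move=> u v; case: (siteP u) => [i r|i j|t|t|s]; case: (siteP v) => [i' r'|i' j'|t'|t'|s'].
all: intros; match goal with H : (_, _) = (_, _) |- _ =>
  case/pair_equal_spec: H => ? ? end.
all: unfold width in *; lia.
Qed.

(* Lattice contacts between a lower and an upper tooth are left out of the graph. *)
Definition cross (p q : nat * nat) : bool := [&& p.2 == 2, q.2 == 3 & 1 < p.1].

Definition edge (p q : nat * nat) : bool :=
  [&& adj p q, ~~ cross p q & ~~ cross q p].

Lemma edgeC p q : edge p q = edge q p.
Proof. by rewrite /edge adjC; congr andb; rewrite andbC. Qed.

Lemma edge_irr p : edge p p = false.
Proof. by case: p => i j; rewrite /edge /adj /=; lia. Qed.

(** A descent to vertex 0 for connectivity. The weight 10 lets one column to the left outweigh a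
    step up, as for upper teeth; [maxn] keeps the parent inside the graph. *)
Lemma edge_parent v : v != 0 -> exists u,
  [/\ u < maxn v (4 * width + 4), edge (site v) (site u)
    & 10 * (site u).1 + (site u).2 < 10 * (site v).1 + (site v).2].
Proof.
case: (siteP v) => [i r -> r4 iw|i j -> i2 j2|t -> tT|t -> tT|s ->] v0.
- case: i iw v0 => [|i] iw v0; last first.
    exists (4 * i + r); rewrite site_strip; try lia.
    by split; rewrite /edge /adj /cross /=; lia.
  case: r r4 v0 => [|[|[|[|//]]]] // _ _.
  + exists (4 * 0 + 0); rewrite site_strip //.
    by split; rewrite /edge /adj /cross /=; lia.
  + exists (4 * width + 2 * 1 + 0); rewrite site_conn //.
    by split; rewrite /edge /adj /cross /=; lia.
  + exists (4 * 0 + 2); rewrite site_strip //.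
    by split; rewrite /edge /adj /cross /=; lia.
- case: i i2 v0 => [|i] i2 v0; last first.
    exists (4 * width + 2 * j + 0); rewrite site_conn //.
    by split; rewrite /edge /adj /cross /=; lia.
  case: j j2 v0 => [|j] j2 v0.
    exists (4 * 0 + 1); rewrite site_strip; try (rewrite /width; lia).
    by split; rewrite /edge /adj /cross /=; lia.
  exists (4 * width + 2 * j + 0); rewrite site_conn; try lia.
  by split; rewrite /edge /adj /cross /=; lia.
- exists (4 * (4 * t + 3 + 2 * b t) + 1); rewrite site_strip; try (rewrite /width; lia).
  by split; rewrite /edge /adj /cross /=; rewrite /width; lia.
- exists (4 * (4 * t + 4 - 2 * a t) + 2); rewrite site_strip; try (rewrite /width; lia).
  by split; rewrite /edge /adj /cross /=; rewrite /width; lia.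
case: s v0 => [|s] _.
  exists (4 * (4 * T + 3) + 0); rewrite site_strip; try (rewrite /width; lia).
  by split; rewrite /edge /adj /cross /width /=; lia.
exists (4 * width + 4 + 2 * T + s); rewrite site_pad.
by split; rewrite /edge /adj /cross /=; lia.
Qed.


(** * Rigidity of the gadget *)

Section Rigid.
Variables (n : nat) (P : nat -> R * R).
Hypothesis n_ge : 4 * width + 4 + 2 * T <= n.
Hypothesis P_edge : forall u v, u < n -> v < n -> edge (site u) (site v) ->
  sqdist (P u) (P v) = 4%R.
Hypothesis P_sep : forall u v, u < n -> v < n -> u <> v ->
  (4 <= sqdist (P u) (P v))%R.

(** Vertices 0, 4 and 1 sit at (0,0), (1,0) and (0,1), so their images are an affine frame for the
    whole drawing. *)
Let along (c0 c1 c2 : R) (p : nat * nat) : R :=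
  (c0 + INR p.1 * (c1 - c0) + INR p.2 * (c2 - c0))%R.

Definition in_place (v : nat) : Prop :=
  (P v).1 = along (P 0).1 (P 4).1 (P 1).1 (site v) /\
  (P v).2 = along (P 0).2 (P 4).2 (P 1).2 (site v).

Lemma in_place_step x u w v : x < n -> u < n -> w < n -> v < n ->
  [&& edge (site x) (site u), edge (site x) (site w), edge (site u) (site w),
      edge (site v) (site u) & edge (site v) (site w)] ->
  site x != site v ->
  (site v).1 + (site x).1 == (site u).1 + (site w).1 ->
  (site v).2 + (site x).2 == (site u).2 + (site w).2 ->
  in_place x -> in_place u -> in_place w -> in_place v.
Proof.
move=> xn un wn vn /and5P[xu xw uw vu vw] xv /eqP e1 /eqP e2 [x1 x2] [u1 u2] [w1 w2].
have [] := rhombus (P_edge xn un xu) (P_edge xn wn xw) (P_edge un wn uw)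
  (P_edge vn un vu) (P_edge vn wn vw) (P_sep xn vn _).
  by move=> E; rewrite E eqxx in xv.
move: e1 e2 => /(congr1 INR) + /(congr1 INR); rewrite !plus_INR => e1 e2 v1 v2.
split; rewrite ?v1 ?v2 ?x1 ?u1 ?w1 ?x2 ?u2 ?w2 /along.
  have -> : INR (site v).1 = (INR (site u).1 + INR (site w).1 - INR (site x).1)%R by lra.
  have -> : INR (site v).2 = (INR (site u).2 + INR (site w).2 - INR (site x).2)%R by lra.
  by ring.
have -> : INR (site v).1 = (INR (site u).1 + INR (site w).1 - INR (site x).1)%R by lra.
have -> : INR (site v).2 = (INR (site u).2 + INR (site w).2 - INR (site x).2)%R by lra.
by ring.
Qed.

Let width_gt3 : 3 < width. Proof. by rewrite /width; lia. Qed.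

Let conn i j := 4 * width + 2 * j + i.

Ltac place x u w :=
  apply: (@in_place_step x u w) => //;
  rewrite /conn ?site_strip ?site_conn ?site_bot ?site_top;
  rewrite /edge /adj /cross ?xpair_eqE /=; try lia.

Lemma strip_in_place r : r = 0 \/ r = 2 ->
  in_place (4 * 0 + r) -> in_place (4 * 0 + (r + 1)) ->
  in_place (4 * 1 + r) -> in_place (4 * 1 + (r + 1)) ->
  forall i, i + 1 < width ->
   [/\ in_place (4 * i + r), in_place (4 * i + (r + 1)),
       in_place (4 * (i + 1) + r) & in_place (4 * (i + 1) + (r + 1))].
Proof.
move=> r02 p00 p01 p10 p11; elim=> [|i IHi] iw; first by split.
have [|p1 p2 p3 p4] := IHi; first by lia.
have p5 : in_place (4 * (i.+1 + 1) + r).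
  by place (4 * i + (r + 1)) (4 * (i + 1) + r) (4 * (i + 1) + (r + 1)).
have iE : i + 1 = i.+1 by lia.
split=> //; try by rewrite -iE.
by place (4 * (i + 1) + r) (4 * (i + 1) + (r + 1)) (4 * (i.+1 + 1) + r).
Qed.

Lemma in_place_base : [/\ in_place 0, in_place 1 & in_place 4].
Proof.
have p1 := @site_strip 0 1; have p4 := @site_strip 1 0; have p0 := @site_strip 0 0.
by split; rewrite /in_place /along ?p0 ?p1 ?p4 //=; try lia; split; ring.
Qed.

(** A chain of rhombi climbs through the connectors and ties the upper strip to the frame of the
    lower one. *)
Lemma upper_in_place :
  [/\ in_place (4 * 0 + 2), in_place (4 * 0 + 3),
      in_place (4 * 1 + 2) & in_place (4 * 1 + 3)].
Proof.
have [p00 p01 p10] := in_place_base.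
have {}p00 : in_place (4 * 0 + 0) by [].
have {}p01 : in_place (4 * 0 + 1) by [].
have {}p10 : in_place (4 * 1 + 0) by [].
have p11 : in_place (4 * 1 + 1) by place (4 * 0 + 0) (4 * 1 + 0) (4 * 0 + 1).
have c00 : in_place (conn 0 0) by place (4 * 1 + 0) (4 * 0 + 1) (4 * 1 + 1).
have c10 : in_place (conn 1 0) by place (4 * 0 + 1) (conn 0 0) (4 * 1 + 1).
have c01 : in_place (conn 0 1) by place (4 * 1 + 1) (conn 0 0) (conn 1 0).
have c11 : in_place (conn 1 1) by place (conn 0 0) (conn 1 0) (conn 0 1).
have u00 : in_place (4 * 0 + 2) by place (conn 1 0) (conn 0 1) (conn 1 1).
have u10 : in_place (4 * 1 + 2) by place (conn 0 1) (conn 1 1) (4 * 0 + 2).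
have u01 : in_place (4 * 0 + 3) by place (conn 1 1) (4 * 0 + 2) (4 * 1 + 2).
have u11 : in_place (4 * 1 + 3) by place (4 * 0 + 2) (4 * 0 + 3) (4 * 1 + 2).
by [].
Qed.

Lemma teeth_in_place t : t < T ->
  in_place (4 * width + 4 + t) /\ in_place (4 * width + 4 + T + t).
Proof.
move=> tT; have wE : width = 4 * T + 4 by [].
have [p00 p01 p10] := in_place_base.
have p11 : in_place (4 * 1 + 1) by place (4 * 0 + 0) (4 * 1 + 0) (4 * 0 + 1).
have lower := strip_in_place (or_introl erefl) p00 p01 p10 p11.
have [u00 u01 u10 u11] := upper_in_place.
have upper := strip_in_place (or_intror erefl) u00 u01 u10 u11.
have [|_ l1 l2 l3] := lower (4 * t + 3 + 2 * b t); first by lia.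
have [|u1 u2 u3 _] := upper (4 * t + 4 - 2 * a t); first by lia.
split.
  by place (4 * (4 * t + 3 + 2 * b t + 1) + 0) (4 * (4 * t + 3 + 2 * b t) + (0 + 1))
    (4 * (4 * t + 3 + 2 * b t + 1) + (0 + 1)).
by place (4 * (4 * t + 4 - 2 * a t) + (2 + 1)) (4 * (4 * t + 4 - 2 * a t) + 2)
    (4 * (4 * t + 4 - 2 * a t + 1) + 2).
Qed.

Lemma teeth_touch t : t < T -> a t != b t ->
  sqdist (P (4 * width + 4 + t)) (P (4 * width + 4 + T + t)) = 4%R.
Proof.
move=> tT ab; have [[b1 b2] [a1 a2]] := teeth_in_place tT.
(* Differing bits put both teeth in one column, 4t+3 or 4t+5, one lattice step apart like vertices 0
   and 1. *)
have iE : 4 * t + 5 - 2 * a t = 4 * t + 3 + 2 * b t.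
  by case: (a t) (b t) ab => -[] //=; lia.
have <- : sqdist (P 0) (P 1) = 4%R.
  apply: P_edge; try lia.
  have p0 := @site_strip 0 0; have p1 := @site_strip 0 1.
  by rewrite p0 ?p1 //; lia.
rewrite /sqdist b1 b2 a1 a2 site_bot // site_top // iE /along /=.
by ring.
Qed.

End Rigid.
End Gadget.

(** * Gadget graphs for equal and for different strings *)

Definition gadget (n T : nat) (a b : nat -> bool) : rel 'I_n :=
  fun u v => edge (site T a b u) (site T a b v).

Lemma gadget_connected n T a b : 4 * width T + 4 + 2 * T <= n ->
  simple_connected (@gadget n T a b).
Proof.
move=> n_ge; have e_sym : symmetric (@gadget n T a b).
  by move=> u v; rewrite /gadget edgeC.
split=> //; split=> [u|]; first exact: edge_irr.
have n_gt0 : 0 < n by lia.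
suff to0 u : connect (@gadget n T a b) u (Ordinal n_gt0).
  move=> u v; apply: connect_trans (to0 u) _.
  by rewrite (sym_connect_sym e_sym).
have [m] := ubnP (10 * (site T a b u).1 + (site T a b u).2).
elim: m u => // m IHm u u_lt.
have [u0|u_neq0] := eqVneq (val u) 0.
  by rewrite (_ : u = Ordinal n_gt0) ?connect0 //; apply: val_inj.
have [v [v_lt uv rank]] := @edge_parent T a b u u_neq0.
have vn : v < n by apply: leq_trans v_lt _; rewrite geq_max ltnW //=; lia.
apply: connect_trans (connect1 _) (IHm (Ordinal vn) _) => //=.
by lia.
Qed.

(** With equal strings, a lower and an upper tooth are at least two columns apart, within a block
    and across blocks. *)
Lemma teeth_apart T a u v :
  adj (site T a a u) (site T a a v) -> ~~ cross (site T a a u) (site T a a v).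
Proof.
case: (siteP T a a u) => [i r _ _ _|i j _ i2 j2|t _ tT|t _ tT|s _];
  case: (siteP T a a v) => [i' r' _ _ _|i' j' _ i2' j2'|t' _ tT'|t' _ tT'|s' _];
  rewrite /adj /cross /=; try lia.
have [?|?|->] := ltngtP t t'; lia.
Qed.

Lemma gadget_penny n T a : penny (@gadget n T a a).
Proof.
apply: (@lattice_penny _ _ (fun v => site T a a v)).
  by move=> u v /(@site_inj T a a) /val_inj.
move=> u v; rewrite /gadget /edge; case: (boolP (adj _ _)) => //= uv.
by rewrite !teeth_apart // adjC.
Qed.

Lemma gadget_not_penny n T a b t : 4 * width T + 4 + 2 * T <= n ->
  t < T -> a t != b t -> ~ penny (@gadget n T a b).
Proof.
move=> n_ge tT ab [p pP]; have n_gt0 : 0 < n by lia.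
pose vert x : 'I_n := insubd (Ordinal n_gt0) x.
have vertE x : x < n -> val (vert x) = x by move=> xn; rewrite val_insubd xn.
have sep u v : u < n -> v < n -> u <> v -> (4 <= sqdist (p (vert u)) (p (vert v)))%R /\
    (edge (site T a b u) (site T a b v) <-> sqdist (p (vert u)) (p (vert v)) = 4%R).
  move=> un vn uv; have := pP (vert u) (vert v); rewrite /gadget !vertE //.
  by apply=> /(congr1 val); rewrite !vertE.
have := @teeth_touch T a b n (fun x => p (vert x)) n_ge _ _ t tT ab.
have bn : 4 * width T + 4 + t < n by lia.
have an : 4 * width T + 4 + T + t < n by lia.
have [_ <-] := sep _ _ bn an ltac:(lia).
rewrite site_bot // site_top //.
(* [cross] removed this contact from the graph, yet the drawing forces it. *)
have -> : edge (4 * t + 3 + 2 * b t, 2) (4 * t + 5 - 2 * a t, 3) = false.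
  by rewrite /edge /cross /=; lia.
move=> touch.
suff: false by [].
apply: touch => [u v un vn uv|u v un vn uv]; last by case: (sep u v un vn uv).
have [|_ <- //] := sep u v un vn.
by move=> E; rewrite E edge_irr in uv.
Qed.

(** * Cutting and pasting along the connectors *)

Definition lower (T v : nat) : bool := (site T xpred0 xpred0 v).2 <= 2.

Lemma site_row T a b v : (site T a b v).2 = (site T xpred0 xpred0 v).2.
Proof. by rewrite /site; do 4 case: ifP => _ //. Qed.

Lemma site_lower T a a' b v : lower T v -> site T a b v = site T a' b v.
Proof. by rewrite /lower /site; do 4 case: ifP => _ //. Qed.

Lemma site_upper T a b b' v : ~~ lower T v -> site T a b v = site T a b' v.
Proof. by rewrite /lower /site; do 4 case: ifP => _ //. Qed.

Definition connector (T v : nat) : bool := 4 * width T <= v < 4 * width T + 4.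

Lemma site_connector T a a' b b' v : connector T v -> site T a b v = site T a' b' v.
Proof. by rewrite /site => /andP[]; rewrite leqNgt => /negbTE -> ->. Qed.

Lemma edge_lower_upper T a b u v : edge (site T a b u) (site T a b v) ->
  lower T u != lower T v -> connector T u && connector T v.
Proof.
rewrite /lower -(site_row T a b u) -(site_row T a b v) /connector.
case: (siteP T a b u) => [i r -> ? ?|i j -> i2 j2|t -> tT|t -> tT|s ->];
  case: (siteP T a b v) => [i' r' -> ? ?|i' j' -> i2' j2'|t' -> tT'|t' -> tT'|s' ->];
  rewrite /edge /adj /cross /=; lia.
Qed.

Lemma view_ext n (e e' : rel 'I_n) id c c' v :
  c v = c' v -> (forall u, e v u = e' v u) -> (forall u, e v u -> c u = c' u) ->
  view e id c v = view e' id c' v.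
Proof.
move=> cv ee cc; rewrite /view cv (eq_filter ee); congr (_, sort _ _).
by apply/eq_in_map => u; rewrite mem_filter -ee => /andP[/cc ->].
Qed.

(** A vertex sees its own half and possibly connectors; the sites and certificates of connectors are
    the same for both strings. *)
Lemma view_gadget n T a b id (c : (nat -> bool) -> 'I_n -> seq bool) (v : 'I_n) :
  (forall u : 'I_n, connector T u -> c a u = c b u) ->
  let d := if lower T v then b else a in
  view (@gadget n T a b) id (fun u => c (if lower T u then b else a) u) v =
  view (@gadget n T d d) id (c d) v.
Proof.
move=> cab d.
have posE (u : 'I_n) : lower T u = lower T v -> site T a b u = site T d d u.
  rewrite /d => <-; case: ifP => lu; first exact: site_lower.
  by apply: site_upper; rewrite lu.
have far (u : 'I_n) a' b' : lower T u != lower T v ->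
    @gadget n T a' b' v u -> connector T u.
  by rewrite eq_sym => luv /edge_lower_upper/(_ luv)/andP[].
apply: view_ext => // u.
  have [luv|luv] := eqVneq (lower T u) (lower T v).
    by rewrite /gadget !posE.
  have [cu|cu] := boolP (connector T u).
    by rewrite /gadget posE // (site_connector a d b d cu).
  by apply/idP/idP => /(far _ _ _ luv) cu'; rewrite cu' in cu.
have [luv|luv] := eqVneq (lower T u) (lower T v); first by rewrite luv.
move/(far _ _ _ luv)/cab; rewrite /d.
by case: (lower T u) (lower T v) => -[].
Qed.

(** * Counting certificates on the connectors *)

Definition pad (l : nat) (s : seq bool) : seq bool :=
  s ++ true :: nseq (l - size s) false.

Lemma size_pad l s : size s <= l -> size (pad l s) == l.+1.
Proof. by move=> sl; rewrite size_cat /= size_nseq; lia. Qed.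

(** The last [true] marks the end of the original string. *)
Lemma pad_inj l s s' : pad l s = pad l s' -> s = s'.
Proof.
rewrite /pad; move: (l - size s) (l - size s') => i j.
have nT k r : nseq k false = r ++ true :: nseq j false -> False.
  by elim: r k => [|x r IHr] [|k] //= [_ /IHr].
have nT' k r : nseq k false = r ++ true :: nseq i false -> False.
  by elim: r k => [|x r IHr] [|k] //= [_ /IHr].
elim: s s' => [|x s IHs] [|y s'] //=.
- by case=> _ /nT.
- by case=> _ /esym/nT'.
by case=> -> /IHs ->.
Qed.

(** There are 2^T strings but only 2^(4(l+1)) quadruples of padded certificates. *)
Lemma pigeonhole T l (c : (nat -> bool) -> 'I_4 -> seq bool) :
  4 * l.+1 < T -> (forall a i, size (c a i) <= l) ->
  exists a b t, [/\ t < T, a t != b t & forall i, c a i = c b i].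
Proof.
move=> lT c_le.
pose w (x : T.-tuple bool) := nth false x.
pose f (x : T.-tuple bool) : {ffun 'I_4 -> l.+1.-tuple bool} :=
  [ffun i => Tuple (size_pad (c_le (w x) i))].
have : ~~ injectiveb f.
  apply/negP => /injectiveP /leq_card.
  rewrite card_ffun !card_tuple card_ord card_bool -expnM leq_exp2l //; lia.
case/injectivePn => x [y xy fxy]; exists (w x), (w y).
have [|no] := classic (exists t, t < T /\ w x t != w y t); last first.
  case/eqP: xy; apply: val_inj; apply: (@eq_from_nth _ false).
    by rewrite !size_tuple.
  move=> i; rewrite size_tuple => iT; apply/eqP/negPn/negP => ne.
  by apply: no; exists i.
case=> t [tT ne]; exists t; split=> // i.
have /(congr1 val) /= := congr1 (fun g : {ffun _} => g i) fxy.
by rewrite !ffunE /= => /pad_inj.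
Qed.

Lemma penny_lower_bound (k n : nat) (S : scheme) : 1 <= k -> 1000 <= n ->
  is_penny_PLS k S ->
  exists (e : rel 'I_n) (id : 'I_n -> nat) (v : 'I_n),
    [/\ simple_connected e, penny e, valid_ids k id &
        n <= 100 * size (prover S e id v)].
Proof.
move=> hk n_ge [compl sound]; apply: NNPP => none.
(* The gadget uses 18T + 20 vertices; the rest is padding. *)
pose T := (n - 20) %/ 18; pose id (v : 'I_n) := v.+1.
have T_le : 4 * width T + 4 + 2 * T <= n by rewrite /width /T; lia.
have idP : valid_ids k id.
  split=> [u v [/val_inj //]|v]; rewrite pow_expn /id /=.
  by apply: leq_trans (ltn_ord v) _; rewrite -{1}[n]expn1 leq_pexp2l //; lia.
pose c a := prover S (@gadget n T a a) id.
have c_le a v : size (c a v) <= n %/ 100.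
  have [le|lt] := leqP n (100 * size (c a v)); last by lia.
  case: none; exists (@gadget n T a a), id, v; split=> //.
    exact: gadget_connected.
  exact: gadget_penny.
have conn_lt (i : 'I_4) : 4 * width T + i < n by have := ltn_ord i; lia.
have [||a [b [t [tT ab cE]]]] :=
    @pigeonhole T (n %/ 100) (fun a i => c a (Ordinal (conn_lt i))).
- by rewrite /T; lia.
- by move=> a i; apply: c_le.
have cab (u : 'I_n) : connector T u -> c a u = c b u.
  move=> /andP[u_ge u_lt]; have ui : u - 4 * width T < 4 by lia.
  have := cE (Ordinal ui); rewrite (_ : Ordinal _ = u) //.
  by apply: val_inj => /=; lia.
(* Some vertex rejects the pasted certificates, yet its view also occurs in a penny gadget with the
   prover's certificates. *)
have [v] := sound n _ id (gadget_connected a b T_le)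
  (gadget_not_penny T_le tT ab) idP (fun u => c (if lower T u then b else a) u).
case/negP; rewrite view_gadget //; apply: compl => //.
  exact: gadget_connected.
exact: gadget_penny.
Qed.

Theorem theorem5p2 (k : nat) (hk : 1 <= k) :
  (* upper bound O(n): one scheme with certificates of length <= b n *)
  (exists (S : scheme) (b N : nat), is_penny_PLS k S /\
     forall n, N <= n -> forall (e : rel 'I_n) (id : 'I_n -> nat),
       simple_connected e -> penny e -> valid_ids k id ->
       forall v, size (prover S e id v) <= b * n) /\
  (* lower bound Omega(n): every scheme uses length >= n/d on some n-vertex penny graph *)
  (exists d N : nat, 0 < d /\
     forall n, N <= n -> forall S : scheme, is_penny_PLS k S ->
       exists (e : rel 'I_n) (id : 'I_n -> nat) (v : 'I_n),
         [/\ simple_connected e, penny e, valid_ids k id &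
             n <= d * size (prover S e id v)]).
Proof.
split.
  exists (penny_scheme k), (1306 + 3 * k), 0; split; first exact: penny_schemeP.
  by move=> n _ e id econ ep idP v; case: (penny_proverP v econ ep idP).
exists 100, 1000; split=> // n n_ge S; exact: penny_lower_bound.
Qed.
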